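(* Let $n\ge 2$ be an integer and let $p_2,\dots,p_n$ be real coefficients such that: - if $n$ is even, then $p_n=1$ and $p_j=0$ for $j=2,\dots,n-1$; - if $n$ is odd, then $p_n>0$, $p_n+p_{\frac{n+1}{2}}=1$, and $p_j=0$ for all $j\in\{2,\dots,n-1\}$ with $j\neq\frac{n+1}{2}$. Set $$c=\frac{n+2p_n+1}{\sqrt{p_n(2n+2)}},\qquad k=\frac{\sqrt{p_n}\,(n-1)}{\sqrt{2n+2}}.$$ Then for every real $p>0$, each of the two functions (one for the upper choice of all signs, one for the lower choice of all signs) $$u(t,x)=\frac{1}{\bigl(1+p\exp\left(\pm k\,(x\mp ct)\right)\bigr)^{\frac{2}{n-1}}},\qquad t,x\in\mathbb{R},$$ is an exact solution of the equation $$u_t(t,x)=u_{xx}(t,x)-\sum_{j=2}^{n}p_j\,u^j(t,x)+u(t,x).$$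
   Context: Here $u=u(t,x)$ is a real-valued function of the one-dimensional variables $t$ and $x$, subscripts $t$ and $x$ denote partial derivatives, and $u^j$ denotes the $j$-th power of $u$. The signs are coupled: the upper signs give $u=(1+p\,e^{k(x-ct)})^{-2/(n-1)}$, and the lower signs give $u=(1+p\,e^{-k(x+ct)})^{-2/(n-1)}$. The positive parameter $p$ is unrelated to the coefficients $p_j$. *)

(* Defs.v *)
From Stdlib Require Export Reals Arith.
From Coquelicot Require Export Coquelicot.
Open Scope R_scope.

(** Classical solutions on the whole plane of
    [u_t = u_xx - sum_(j=2..n) p_j u^j + u].
    [Derive] and [Derive_n] are total, so the existence of [u_t], [u_x] and
    [u_xx] is required separately; [ex_derive_n _ 2] alone would not imply
    that the first derivative exists. *)
Definition is_exact_solution (n : nat) (p : nat -> R) (u : R -> R -> R) : Prop :=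
  forall t x : R,
    ex_derive (fun s => u s x) t /\
    ex_derive (fun y => u t y) x /\
    ex_derive_n (fun y => u t y) 2 x /\
    Derive (fun s => u s x) t =
      Derive_n (fun y => u t y) 2 x
      - sum_n_m (fun j => p j * u t x ^ j) 2 n
      + u t x.

(* Main.v *)
(** With [V = 1 / (1 + q e^y)] and [U = V^a], [a = 2/(n-1)], one has
    [U' = - a U (1 - V)], [V' = - V (1 - V)], and [V^2 = U^(n-1)]. Hence along
    the wave [y = kappa x - omega t] the reaction term is
    [U (1 - V) (1 + p_n V)], every term of the equation is [U (1 - V)] times an
    affine function of [V], and comparing coefficients leaves
    [a omega = 1 + a^2 kappa^2] and [a (a + 1) kappa^2 = p_n]. *)
Require Import Defs.
From Stdlib Require Import Reals Arith Lra Lia FunctionalExtensionality.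
From Coquelicot Require Import Coquelicot.
Open Scope R_scope.

Definition logistic (q y : R) : R := / (1 + q * exp y).

(** The quotient form, rather than a power of [logistic], makes the functions of the theorem
    instances by unfolding. *)
Definition profile (q a y : R) : R := 1 / Rpower (1 + q * exp y) a.

Lemma one_plus_exp_pos (q y : R) : 0 < q -> 0 < 1 + q * exp y.
Proof.
  intros hq.
  assert (H := Rmult_lt_0_compat _ _ hq (exp_pos y)). lra.
Qed.

Lemma is_derive_logistic (q y : R) : 0 < q ->
  is_derive (logistic q) y (- logistic q y * (1 - logistic q y)).
Proof.
  intros hq. assert (H := one_plus_exp_pos q y hq).
  unfold logistic. auto_derive; [lra | field; lra].
Qed.

Lemma is_derive_profile (q a y : R) : 0 < q ->
  is_derive (profile q a) y (- a * profile q a y * (1 - logistic q y)).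
Proof.
  intros hq. assert (H := one_plus_exp_pos q y hq).
  unfold profile, logistic, Rpower.
  assert (He := exp_pos (a * ln (1 + q * exp y))).
  auto_derive.
  - repeat split; lra.
  - field. lra.
Qed.

Lemma profile_Rpower (q a y : R) : 0 < q ->
  profile q a y = Rpower (logistic q y) a.
Proof.
  intros hq. assert (H := one_plus_exp_pos q y hq).
  unfold profile, logistic, Rpower.
  rewrite ln_Rinv by lra.
  rewrite Ropp_mult_distr_r_reverse, exp_Ropp. unfold Rdiv. ring.
Qed.

(** Both sides are real powers of the positive number [logistic q y], with exponents [a * INR i] and
    [INR j]. *)
Lemma profile_pow (q a y : R) (i j : nat) : 0 < q ->
  a * INR i = INR j -> profile q a y ^ i = logistic q y ^ j.
Proof.
  intros hq Hij.
  assert (HV : 0 < logistic q y)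
    by (apply Rinv_0_lt_compat, one_plus_exp_pos, hq).
  rewrite profile_Rpower by exact hq.
  rewrite <- Rpower_pow by apply exp_pos.
  rewrite Rpower_mult, Hij. apply Rpower_pow, HV.
Qed.

Lemma sum_n_m_zero (f : nat -> R) (a b : nat) :
  (forall j, (a <= j <= b)%nat -> f j = 0) -> sum_n_m f a b = 0.
Proof.
  intros H.
  rewrite (sum_n_m_ext_loc f (fun _ => zero)) by exact H.
  apply (sum_n_m_const_zero (G := R_AbelianMonoid)).
Qed.

Lemma sum_n_m_single (f : nat -> R) (a b m : nat) : (a <= m <= b)%nat ->
  (forall j, (a <= j <= b)%nat -> j <> m -> f j = 0) -> sum_n_m f a b = f m.
Proof.
  intros Hm H.
  rewrite (sum_n_m_Chasles f a m b) by lia.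
  rewrite (sum_n_m_zero f (S m) b) by (intros j Hj; apply H; lia).
  change plus with Rplus. rewrite Rplus_0_r.
  destruct m as [|m].
  - replace a with 0%nat by lia. apply sum_n_n.
  - rewrite sum_n_Sm by lia.
    rewrite (sum_n_m_zero f a m) by (intros j Hj; apply H; lia).
    apply Rplus_0_l.
Qed.

(** Since [a * (n - 1) = 2], the top power is [u ^ n = u * v ^ 2]. For [n = 2 * m + 1] also
    [a * m = 1], so the middle power is [u ^ (m + 1) = u * v], with coefficient [1 - p n]. For even
    [n] this coefficient is 0, so one formula serves both parities. *)
Lemma reaction_sum (n : nat) (p : nat -> R) (q y : R)
  (hn : (2 <= n)%nat)
  (heven : Nat.Even n ->
     p n = 1 /\ (forall j : nat, (2 <= j <= n - 1)%nat -> p j = 0))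
  (hodd : Nat.Odd n ->
     0 < p n /\ p n + p ((n + 1) / 2)%nat = 1 /\
     (forall j : nat, (2 <= j <= n - 1)%nat -> j <> ((n + 1) / 2)%nat -> p j = 0)) :
  0 < q ->
  let u := profile q (2 / (INR n - 1)) y in
  let v := logistic q y in
  sum_n_m (fun j => p j * u ^ j) 2 n = u * (p n * v ^ 2 + (1 - p n) * v).
Proof.
  intros hq u v.
  destruct n as [|N]; [lia|].
  assert (HN : INR N <> 0) by (apply not_0_INR; lia).
  assert (HuN : u ^ N = v ^ 2).
  { apply profile_pow; [exact hq|].
    rewrite S_INR. simpl (INR 2). field. lra. }
  rewrite sum_n_Sm by lia. change plus with Rplus. match goal with |- @eq _ ?x ?y => change (@eq R x y) end.
  rewrite <- tech_pow_Rmult, HuN.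
  destruct (Nat.Even_or_Odd (S N)) as [Hp|Hp].
  - destruct (heven Hp) as [H1 H0].
    rewrite sum_n_m_zero.
    + rewrite H1. ring.
    + intros j Hj. rewrite H0 by lia. ring.
  - destruct (hodd Hp) as [_ [H1 H0]]. destruct Hp as [m Hm].
    (* The division is exact because [S N = 2 * m + 1]. As [m >= 1], the index [S m] lies between 2
       and [N], apart from the top index. *)
    assert (Hh : ((S N + 1) / 2 = S m)%nat).
    { replace (S N + 1)%nat with (S m * 2)%nat by lia. apply Nat.div_mul. lia. }
    rewrite Hh in H0, H1.
    rewrite (sum_n_m_single _ 2 N (S m)) by
      (lia || (intros j Hj Hne; rewrite H0 by lia; ring)).
    assert (Hum : u ^ m = v ^ 1).
    { apply profile_pow; [exact hq|].
      rewrite S_INR. replace N with (2 * m)%nat in * by lia.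
      rewrite mult_INR in *. simpl (INR 2) in *. simpl (INR 1). field. lra. }
    rewrite <- tech_pow_Rmult, Hum.
    replace (p (S m)) with (1 - p (S N)) by lra. ring.
Qed.

(** Only [kappa ^ 2] enters the two conditions, so both directions of travel are covered. The phase
    [phi] is fixed only pointwise, which admits the factored phases of the theorem. *)
Lemma profile_wave_solution (n : nat) (p : nat -> R) (q a kappa omega : R)
  (phi : R -> R -> R) :
  0 < q ->
  (forall t x, phi t x = kappa * x - omega * t) ->
  a * omega = 1 + a ^ 2 * kappa ^ 2 ->
  a * (a + 1) * kappa ^ 2 = p n ->
  (forall y, let u := profile q a y in let v := logistic q y in
     sum_n_m (fun j => p j * u ^ j) 2 n = u * (p n * v ^ 2 + (1 - p n) * v)) ->
  is_exact_solution n p (fun t x => profile q a (phi t x)).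
Proof.
  intros hq Hphi Homega Hkappa Hsum.
  replace phi with (fun t x => kappa * x - omega * t)
    by (do 2 (apply functional_extensionality; intro); now rewrite Hphi).
  intros t x.
  set (U := profile q a). set (V := logistic q).
  assert (HU : forall y, is_derive U y (- a * U y * (1 - V y)))
    by (intros; now apply is_derive_profile).
  assert (HV : forall y, is_derive V y (- V y * (1 - V y)))
    by (intros; now apply is_derive_logistic).
  assert (Hx : forall z, is_derive (fun y => U (kappa * y - omega * t)) z
    (kappa * (- a * U (kappa * z - omega * t) * (1 - V (kappa * z - omega * t))))).
  { intros z. apply (is_derive_comp U); [apply HU|]. auto_derive; [easy|ring]. }
  assert (Ht : is_derive (fun s => U (kappa * x - omega * s)) t
    (- omega * (- a * U (kappa * x - omega * t) * (1 - V (kappa * x - omega * t))))).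
  { apply (is_derive_comp U); [apply HU|]. auto_derive; [easy|ring]. }
  set (w := kappa * x - omega * t) in *.
  assert (Hxx : is_derive (Derive (fun y => U (kappa * y - omega * t))) x
    (kappa ^ 2 * (a * U w * (1 - V w) * (a * (1 - V w) - V w)))).
  (* [Hx] gives the first derivative at every point, so its closed form can be differentiated
     again. *)
  { apply (is_derive_ext (fun z => kappa * (- a * U (kappa * z - omega * t)
       * (1 - V (kappa * z - omega * t))))).
    { intros z. symmetry. apply is_derive_unique, Hx. }
    auto_derive.
    - repeat split; eexists; (apply HU || apply HV).
    - change (fun y => U y) with U. change (fun y => V y) with V.
      rewrite (is_derive_unique _ _ _ (HU _)), (is_derive_unique _ _ _ (HV _)).
      unfold w, Rminus. ring. }
  split; [eexists; exact Ht|].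
  split; [eexists; apply Hx|].
  split; [eexists; exact Hxx|].
  change (Derive_n (fun y => U (kappa * y - omega * t)) 2 x)
    with (Derive (Derive (fun y => U (kappa * y - omega * t))) x).
  replace (Derive (fun s => U (kappa * x - omega * s)) t)
    with (- omega * (- a * U w * (1 - V w)))
    by (symmetry; exact (is_derive_unique _ _ _ Ht)).
  rewrite (is_derive_unique _ _ _ Hxx).
  fold w. unfold U, V. rewrite (Hsum w).
  (* After division by [U * (1 - V)], diffusion gives [a * kappa ^ 2 * (a - (a + 1) * V)] and
     reaction gives [1 + p n * V]. This value of [p n] cancels the terms in [V], leaving
     [1 + a ^ 2 * kappa ^ 2]. *)
  rewrite <- Hkappa.
  transitivity (a * omega * (profile q a w * (1 - logistic q w))); [ring|].
  rewrite Homega. ring.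
Qed.

Theorem theorem1 (n : nat) (p : nat -> R)
  (hn : (2 <= n)%nat)
  (heven : Nat.Even n ->
     p n = 1 /\ (forall j : nat, (2 <= j <= n - 1)%nat -> p j = 0))
  (hodd : Nat.Odd n ->
     0 < p n /\ p n + p ((n + 1) / 2)%nat = 1 /\
     (forall j : nat, (2 <= j <= n - 1)%nat -> j <> ((n + 1) / 2)%nat -> p j = 0)) :
  let c := (INR n + 2 * p n + 1) / sqrt (p n * (2 * INR n + 2)) in
  let k := sqrt (p n) * (INR n - 1) / sqrt (2 * INR n + 2) in
  forall q : R, 0 < q ->
    is_exact_solution n p
      (fun t x => 1 / Rpower (1 + q * exp (k * (x - c * t))) (2 / (INR n - 1))) /\
    is_exact_solution n p
      (fun t x => 1 / Rpower (1 + q * exp (- k * (x + c * t))) (2 / (INR n - 1))).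
Proof.
  intros c k q hq.
  assert (Hn : 2 <= INR n) by (apply (le_INR 2), hn).
  assert (Hp : 0 < p n).
  { destruct (Nat.Even_or_Odd n) as [H|H].
    - rewrite (proj1 (heven H)). lra.
    - apply (hodd H). }
  assert (Hsp := sqrt_lt_R0 _ Hp).
  assert (Hsn : 0 < sqrt (2 * INR n + 2)) by (apply sqrt_lt_R0; lra).
  assert (Ep : sqrt (p n) ^ 2 = p n) by (apply pow2_sqrt; lra).
  assert (En : sqrt (2 * INR n + 2) ^ 2 = 2 * INR n + 2) by (apply pow2_sqrt; lra).
  (* Only [k ^ 2] and [k * c] are needed, and both are free of square roots: in [k * c] the factor
     [sqrt (p n)] cancels. *)
  assert (Hk : k ^ 2 = p n * (INR n - 1) ^ 2 / (2 * INR n + 2)).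
  { rewrite <- Ep, <- En. unfold k. field. lra. }
  assert (Hkc : k * c = (INR n + 2 * p n + 1) * (INR n - 1) / (2 * INR n + 2)).
  { rewrite <- En. unfold k, c. rewrite sqrt_mult by lra. field. lra. }
  (* Both sides equal [1 + 2 * p n / (n + 1)]. *)
  assert (Homega : 2 / (INR n - 1) * (k * c) = 1 + (2 / (INR n - 1)) ^ 2 * k ^ 2).
  { rewrite Hk, Hkc. field. lra. }
  assert (Hkappa : 2 / (INR n - 1) * (2 / (INR n - 1) + 1) * k ^ 2 = p n).
  { rewrite Hk. field. lra. }
  assert (Hsum := fun y => reaction_sum n p q y hn heven hodd hq).
  assert (Hopp : (- k) ^ 2 = k ^ 2) by ring.
  split.
  - apply (profile_wave_solution n p q _ k (k * c) (fun t x => k * (x - c * t)));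
      try assumption.
    intros; ring.
  (* The lower signs flip [kappa] but keep [omega = k * c]. *)
  - apply (profile_wave_solution n p q _ (- k) (k * c) (fun t x => - k * (x + c * t)));
      rewrite ?Hopp; try assumption.
    intros; ring.
Qed.
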